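(* Let $f(z)=\sum_{k\ge0}a_kz^k$ have finite radius of convergence $0<R<\infty$, and let $n$ satisfy $a_n\neq 0$. Then \[ \lim_{r\to R}\kappa(n,r)=\frac{\|f\|_{H^1(D_R)}}{|a_n|R^n}, \] and this limit is finite if and only if $f$ belongs to the Hardy space $H^1(D_R)$. If $n>\nu$ then $\kappa(n,r)$ is strictly decreasing for $0<r<R$; whereas if $\nu=\infty$ then, for all $n$ with $a_n\ne0$, $\kappa(n,r)$ is strictly increasing for $r$ in some interval $(r_0,R)$.
   Context: For $0<r<R$: $M_1(r)=\frac{1}{2\pi}\int_0^{2\pi}|f(re^{i\theta})|\,d\theta$, $\kappa(n,r)=M_1(r)/(|a_n|r^n)$. The Hardy norm is $\|f\|_{H^1(D_R)}=\sup_{0<r<R}M_1(r)=\lim_{r\to R}M_1(r)\in(0,\infty]$; $f\in H^1(D_R)$ means this is finite. With $\sigma(r)=\log M_1(r)$ (which is differentiable with $\sigma'>0$ on $(0,R)$), $\nu=\sup_{0<r<R} r\sigma'(r)=\lim_{r\to R}r\sigma'(r)\in(0,\infty]$. *)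

(* Defs.v *)
From Stdlib Require Import Reals.
From Coquelicot Require Import Coquelicot.
Open Scope R_scope.

Definition psum (a : nat -> C) (z : C) : C :=
  (Series (fun k => Re (mult (a k) (pow_n z k))),
   Series (fun k => Im (mult (a k) (pow_n z k)))).

(* Radius of convergence of sum a_k z^k (Cauchy-Hadamard: that of sum |a_k| x^k). *)
Definition radius (a : nat -> C) : Rbar := CV_radius (fun k => Cmod (a k)).

Definition M1 (a : nat -> C) (r : R) : R :=
  / (2 * PI) * RInt (fun t => Cmod (psum a (r * cos t, r * sin t))) 0 (2 * PI).

Definition kappa (a : nat -> C) (n : nat) (r : R) : R :=
  M1 a r / (Cmod (a n) * r ^ n).

Definition hardy_norm (a : nat -> C) (Rad : R) : Rbar :=
  Lub_Rbar (fun y => exists r, 0 < r < Rad /\ y = M1 a r).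

Definition in_H1 (a : nat -> C) (Rad : R) : Prop := is_finite (hardy_norm a Rad).

Definition sigma (a : nat -> C) (r : R) : R := ln (M1 a r).
Definition nu (a : nat -> C) (Rad : R) : Rbar :=
  Lub_Rbar (fun y => exists r, 0 < r < Rad /\ y = r * Derive (sigma a) r).

(* Main.v *)
(* The heart of the matter is Hardy's theorem that log M_1(r) is convex in log r, here
   with polynomials approximating f uniformly on circles.  For a polynomial p, pairing
   p(z e^{it}) with a continuous approximation of
   conj p(r e^{it}) / |p(r e^{it})| yields a
   polynomial F with |F(z)| <= M_1(|z|) and F(r) close to M_1(r), so Hadamard's three circles
   theorem for F suffices.  The latter needs no maximum principle: Cauchy's estimate on
   two circles bounds each coefficient of F^N on the intermediate circle, hence
   |F|^N <= (N deg F + 1) X^N, and N -> oo removes the factor.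

   Monotonicity of M_1 gives the limit of kappa.  Since r sigma'(r) is the slope of sigma
   against log r, convexity compares it with all chords, and
   log kappa(n, r) = sigma(r) - n log r - log |a_n| gives both monotonicity claims. *)

Require Import Defs.
From Stdlib Require Import Reals Lra Lia Psatz.
From Coquelicot Require Import Coquelicot.
Open Scope R_scope.

(** * Polynomials and the power trick *)

(** A polynomial is a coefficient sequence with a degree bound, so the truncations of a power series
    all share the sequence [a]. *)
Fixpoint peval (a : nat -> C) (d : nat) (z : C) : C :=
  match d with
  | O => a O
  | S d' => (peval a d' z + a (S d') * z ^ S d')%C
  end.

Lemma peval_S (a : nat -> C) (d : nat) (z : C) :
  peval a (S d) z = (peval a d z + a (S d) * z ^ S d)%C.
Proof. reflexivity. Qed.

Lemma peval_ext (a b : nat -> C) (d : nat) (z : C) :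
  (forall k, (k <= d)%nat -> a k = b k) -> peval a d z = peval b d z.
Proof.
  induction d as [|d IH]; intros H; simpl.
  - apply H; lia.
  - rewrite IH by (intros; apply H; lia).
    now rewrite (H (S d)) by lia.
Qed.

Lemma peval_plus (a b : nat -> C) (d : nat) (z : C) :
  peval (fun k => a k + b k)%C d z = (peval a d z + peval b d z)%C.
Proof. induction d as [|d IH]; simpl; [easy|]. rewrite IH; ring. Qed.

Lemma peval_scal (c : C) (a : nat -> C) (d : nat) (z : C) :
  peval (fun k => c * a k)%C d z = (c * peval a d z)%C.
Proof. induction d as [|d IH]; simpl; [easy|]. rewrite IH; ring. Qed.

Lemma peval_horner (a : nat -> C) (d : nat) (z : C) :
  peval a (S d) z = (a O + z * peval (fun k => a (S k)) d z)%C.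
Proof.
  induction d as [|d IH]; [simpl; ring|].
  rewrite peval_S, IH; simpl; ring.
Qed.

Lemma peval_pad (a : nat -> C) (d e : nat) (z : C) : (d <= e)%nat ->
  peval (fun k => if Nat.leb k d then a k else RtoC 0) e z = peval a d z.
Proof.
  intros H; induction H as [|e H IH].
  - apply peval_ext; intros k Hk.
    now rewrite (proj2 (Nat.leb_le k d) Hk).
  - rewrite peval_S, IH.
    replace (Nat.leb (S e) d) with false by (symmetry; apply Nat.leb_gt; lia).
    ring.
Qed.

(** Induction on [d] through a(z) = a_0 + z a'(z), with [a'] the shifted sequence. Existence of the
    coefficients is enough: they will be estimated from the values of the product. *)
Lemma peval_mult (a b : nat -> C) (d e : nat) :
  exists c, forall z, peval c (d + e) z = (peval a d z * peval b e z)%C.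
Proof.
  revert a; induction d as [|d IH]; intros a.
  - exists (fun k => a O * b k)%C; intros z; apply peval_scal.
  - destruct (IH (fun k => a (S k))) as [c Hc].
    pose (c' := fun k => match k with O => RtoC 0 | S j => c j end).
    pose (b' := fun k => if Nat.leb k e then b k else RtoC 0).
    exists (fun k => c' k + a O * b' k)%C; intros z.
    rewrite peval_plus, peval_scal; unfold b'; rewrite peval_pad by lia.
    replace (S d + e)%nat with (S (d + e)) by lia.
    rewrite (peval_horner c'), (peval_horner a).
    rewrite (peval_ext (fun k => c' (S k)) c) by easy.
    rewrite Hc; change (c' O) with (RtoC 0). ring.
Qed.

Lemma peval_pow (a : nat -> C) (d N : nat) :
  exists c, forall z, peval c (N * d) z = (peval a d z ^ N)%C.
Proof.
  induction N as [|N [c Hc]].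
  - now exists (fun _ => RtoC 1).
  - destruct (peval_mult a c d (N * d)) as [c' Hc'].
    exists c'; intros z; simpl; rewrite Hc', Hc; easy.
Qed.

Lemma Cmod_peval_le (a : nat -> C) (d : nat) (z : C) (X : R) :
  (forall k, (k <= d)%nat -> Cmod (a k) * Cmod z ^ k <= X) ->
  Cmod (peval a d z) <= (INR d + 1) * X.
Proof.
  induction d as [|d IH]; intros H; [simpl|rewrite S_INR, peval_S].
  - generalize (H O (Nat.le_refl _)); simpl; lra.
  - eapply Rle_trans; [apply Cmod_triangle|].
    rewrite Cmod_mult, Cmod_pow.
    assert (H1 := IH (fun k Hk => H k (Nat.le_le_succ_r _ _ Hk))).
    assert (H2 := H (S d) (Nat.le_refl _)); lra.
Qed.

(** If x = 1 + h with h > 0, Bernoulli's inequality gives x^(2N) >= (1 + N h)^2, whose quadratic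
    term beats the linear bound. *)
Lemma pow_linear_bound_le_1 (x D : R) : 0 <= x ->
  (forall N : nat, x ^ N <= INR N * D + 1) -> x <= 1.
Proof.
  intros Hx H; destruct (Rle_or_lt x 1) as [|Hlt]; [easy|exfalso].
  set (h := x - 1); assert (Hh : 0 < h) by (unfold h; lra).
  assert (Hb : forall N, 1 + INR N * h <= x ^ N).
  { induction N as [|N IH]; [simpl; lra|].
    rewrite S_INR; simpl pow; replace x with (1 + h) at 1 by (unfold h; ring).
    assert (0 <= INR N) by apply pos_INR.
    assert ((1 + h) * (1 + INR N * h) <= (1 + h) * x ^ N)
      by (apply Rmult_le_compat_l; lra).
    assert (0 <= INR N * h * h) by (repeat apply Rmult_le_pos; lra).
    lra. }
  (* This makes N h^2 > 2 D, hence N^2 h^2 > 2 N D; the maximum with 1 keeps N positive whatever the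
     sign of [D]. *)
  destruct (INR_unbounded (Rmax (2 * D / (h * h)) 1)) as [N HN].
  assert (HN1 := Rmax_l (2 * D / (h * h)) 1).
  assert (HN2 := Rmax_r (2 * D / (h * h)) 1).
  assert (Hhh : 0 < h * h) by nra.
  assert (HN' : 2 * D < INR N * (h * h)).
  { replace (2 * D) with (2 * D / (h * h) * (h * h)) by (field; lra).
    apply Rmult_lt_compat_r; lra. }
  assert (H1 := H (N + N)%nat).
  rewrite pow_add, plus_INR in H1.
  assert (H2 := Hb N).
  assert (Hpos : 0 < INR N * h) by (apply Rmult_lt_0_compat; lra).
  assert (Hsq : (1 + INR N * h) * (1 + INR N * h) <= x ^ N * x ^ N)
    by (apply Rmult_le_compat; lra).
  assert (INR N * (2 * D) <= INR N * (INR N * (h * h)))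
    by (apply Rmult_le_compat_l; lra).
  lra.
Qed.

(* The crude bound on [peval a d ^ N] loses only a factor linear in [N]. *)
Lemma Cmod_peval_le_of_pow_coef (a : nat -> C) (d : nat) (rho X : R) :
  0 <= rho -> 0 < X ->
  (forall N c, (forall z, peval c (N * d) z = (peval a d z ^ N)%C) ->
     forall k, (k <= N * d)%nat -> Cmod (c k) * rho ^ k <= X ^ N) ->
  Cmod (peval a d rho) <= X.
Proof.
  intros Hrho HX H.
  assert (HX' := Rinv_0_lt_compat _ HX).
  enough (Cmod (peval a d rho) * / X <= 1).
  { apply Rmult_le_reg_r with (/ X); [easy|]. rewrite Rinv_r; lra. }
  apply pow_linear_bound_le_1 with (INR d).
  { apply Rmult_le_pos; [apply Cmod_ge_0|lra]. }
  intros N; destruct (peval_pow a d N) as [c Hc].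
  rewrite Rpow_mult_distr, <- Cmod_pow, <- Hc, <- mult_INR, pow_inv.
  assert (HXN : 0 < X ^ N) by (apply pow_lt; easy).
  apply Rmult_le_reg_r with (X ^ N); [easy|].
  rewrite Rmult_assoc, Rinv_l, Rmult_1_r by lra.
  apply Cmod_peval_le; intros k Hk.
  rewrite Cmod_R, Rabs_pos_eq by easy.
  now apply (H N c Hc).
Qed.

(** * Circle means, Cauchy's estimate and three circles *)

(* Componentwise, so that only real integrals are manipulated. *)
Definition is_CInt (f : R -> C) (l : C) : Prop :=
  is_RInt (fun t => fst (f t)) 0 (2 * PI) (fst l) /\
  is_RInt (fun t => snd (f t)) 0 (2 * PI) (snd l).

Definition Ccontinuous (f : R -> C) : Prop :=
  (forall t, continuous (fun t => fst (f t)) t) /\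
  (forall t, continuous (fun t => snd (f t)) t).

Lemma two_PI_pos : 0 < 2 * PI.
Proof. generalize PI_RGT_0; lra. Qed.

Lemma is_CInt_ext (f g : R -> C) (l : C) :
  (forall t, f t = g t) -> is_CInt f l -> is_CInt g l.
Proof.
  intros H [H1 H2]; split; (eapply is_RInt_ext; [|eassumption]);
    intros; simpl; now rewrite H.
Qed.

Lemma is_CInt_plus (f g : R -> C) (l m : C) :
  is_CInt f l -> is_CInt g m -> is_CInt (fun t => f t + g t)%C (l + m)%C.
Proof.
  intros [H1 H2] [H3 H4]; split; simpl;
    [apply (is_RInt_plus _ _ _ _ _ _ H1 H3) | apply (is_RInt_plus _ _ _ _ _ _ H2 H4)].
Qed.

Lemma is_CInt_mult_l (c : C) (f : R -> C) (l : C) :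
  is_CInt f l -> is_CInt (fun t => c * f t)%C (c * l)%C.
Proof.
  intros [H1 H2]; split; simpl.
  - apply (is_RInt_minus _ _ _ _ _ _ (is_RInt_scal _ _ _ (fst c) _ H1)
                                     (is_RInt_scal _ _ _ (snd c) _ H2)).
  - apply (is_RInt_plus _ _ _ _ _ _ (is_RInt_scal _ _ _ (fst c) _ H2)
                                    (is_RInt_scal _ _ _ (snd c) _ H1)).
Qed.

(** The norm of the product [R * R] is Euclidean, hence equal to [Cmod], so the vector-valued
    triangle inequality for integrals applies. *)
Lemma Cmod_is_CInt_le (f : R -> C) (g : R -> R) (l : C) (m : R) :
  (forall t, Cmod (f t) <= g t) -> is_CInt f l -> is_RInt g 0 (2 * PI) m ->
  Cmod l <= m.
Proof.
  intros H [H1 H2] Hg.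
  assert (HI := is_RInt_fct_extend_pair f 0 (2 * PI) _ _ H1 H2).
  rewrite Cmod_norm, (surjective_pairing l).
  eapply (norm_RInt_le f g 0 (2 * PI)); [|intros x _|exact HI|exact Hg].
  - generalize two_PI_pos; lra.
  - eapply Rle_trans; [|apply H]. rewrite Cmod_norm; apply Rle_refl.
Qed.

Lemma ex_RInt_continuous_R (f : R -> R) (a b : R) :
  (forall t, continuous f t) -> ex_RInt f a b.
Proof. intros H; apply (ex_RInt_continuous f); auto. Qed.

Definition CInt (f : R -> C) : C :=
  (RInt (fun t => fst (f t)) 0 (2 * PI), RInt (fun t => snd (f t)) 0 (2 * PI)).

Lemma CInt_correct (f : R -> C) : Ccontinuous f -> is_CInt f (CInt f).
Proof.
  intros [H1 H2]; split; apply (RInt_correct (V := R_CompleteNormedModule));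
    now apply ex_RInt_continuous_R.
Qed.

Lemma Ccontinuous_const (c : C) : Ccontinuous (fun _ => c).
Proof. split; intros t; apply continuous_const. Qed.

Lemma Ccontinuous_plus (f g : R -> C) :
  Ccontinuous f -> Ccontinuous g -> Ccontinuous (fun t => f t + g t)%C.
Proof.
  intros [H1 H2] [H3 H4]; split; intros t; simpl;
    [apply (continuous_plus _ _ _ (H1 t) (H3 t)) | apply (continuous_plus _ _ _ (H2 t) (H4 t))].
Qed.

Lemma Ccontinuous_mult (f g : R -> C) :
  Ccontinuous f -> Ccontinuous g -> Ccontinuous (fun t => f t * g t)%C.
Proof.
  intros [H1 H2] [H3 H4]; split; intros t; simpl.
  - apply (continuous_minus (fun t => fst (f t) * fst (g t)) (fun t => snd (f t) * snd (g t)));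
      [apply (continuous_mult _ _ _ (H1 t) (H3 t)) | apply (continuous_mult _ _ _ (H2 t) (H4 t))].
  - apply (continuous_plus (fun t => fst (f t) * snd (g t)) (fun t => snd (f t) * fst (g t)));
      [apply (continuous_mult _ _ _ (H1 t) (H4 t)) | apply (continuous_mult _ _ _ (H2 t) (H3 t))].
Qed.

Lemma Ccontinuous_pow (f : R -> C) (n : nat) :
  Ccontinuous f -> Ccontinuous (fun t => f t ^ n)%C.
Proof.
  intros H; induction n as [|n IH]; [apply (Ccontinuous_const (RtoC 1))|].
  apply (Ccontinuous_mult _ _ H IH).
Qed.

Lemma Ccontinuous_conj (f : R -> C) :
  Ccontinuous f -> Ccontinuous (fun t => Cconj (f t)).
Proof.
  intros [H1 H2]; split; intros t; simpl; [apply H1|].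
  apply (continuous_opp _ _ (H2 t)).
Qed.

Lemma Ccontinuous_RtoC (f : R -> R) :
  (forall t, continuous f t) -> Ccontinuous (fun t => RtoC (f t)).
Proof. intros H; split; [exact H|intros t; apply continuous_const]. Qed.

Lemma continuous_Cmod (f : R -> C) (t : R) :
  Ccontinuous f -> continuous (fun t => Cmod (f t)) t.
Proof.
  intros [H1 H2]; unfold Cmod.
  apply (continuous_comp (fun t => fst (f t) ^ 2 + snd (f t) ^ 2) sqrt);
    [|apply continuous_sqrt].
  apply (continuous_plus (fun t => fst (f t) ^ 2) (fun t => snd (f t) ^ 2)).
  - apply (continuous_comp (fun t => fst (f t)) (fun x => x ^ 2)); [apply H1|].
    apply continuity_pt_filterlim, derivable_continuous_pt, derivable_pt_pow.
  - apply (continuous_comp (fun t => snd (f t)) (fun x => x ^ 2)); [apply H2|].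
    apply continuity_pt_filterlim, derivable_continuous_pt, derivable_pt_pow.
Qed.

Lemma Ccontinuous_peval (a : nat -> C) (d : nat) (f : R -> C) :
  Ccontinuous f -> Ccontinuous (fun t => peval a d (f t)).
Proof.
  intros H; induction d as [|d IH]; [apply (Ccontinuous_const (a O))|].
  apply (Ccontinuous_plus _ _ IH).
  apply Ccontinuous_mult; [apply Ccontinuous_const|now apply Ccontinuous_pow].
Qed.

Definition expi (t : R) : C := (cos t, sin t).

Lemma expi_plus (s t : R) : expi (s + t) = (expi s * expi t)%C.
Proof.
  unfold expi, Cmult; simpl. rewrite cos_plus, sin_plus. f_equal; ring.
Qed.

Lemma expi_pow (t : R) (k : nat) : (expi t ^ k)%C = expi (INR k * t).
Proof.
  induction k as [|k IH].
  - simpl; rewrite Rmult_0_l; unfold expi; now rewrite cos_0, sin_0.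
  - rewrite Cpow_S, IH, S_INR, <- expi_plus; f_equal; ring.
Qed.

Lemma Cmod_expi (t : R) : Cmod (expi t) = 1.
Proof.
  unfold Cmod, expi; simpl fst; simpl snd.
  rewrite <- !Rsqr_pow2, Rplus_comm, sin2_cos2; apply sqrt_1.
Qed.

Lemma Ccontinuous_expi_lin (w s : R) : Ccontinuous (fun t => expi (w * t + s)).
Proof.
  split; intros t; simpl; apply (@ex_derive_continuous R_AbsRing R_NormedModule); auto_derive; easy.
Qed.

Lemma polar_expi (r t : R) : ((r * cos t, r * sin t) : C) = (r * expi t)%C.
Proof. unfold expi, Cmult, RtoC; simpl; f_equal; ring. Qed.

Lemma Cmod_polar (r t : R) : 0 <= r -> Cmod (r * cos t, r * sin t) = r.
Proof.
  intros H; rewrite polar_expi, Cmod_mult, Cmod_expi, Cmod_R, Rabs_pos_eq; lra.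
Qed.

Lemma cos_sin_int (k l : nat) :
  cos ((INR l - INR k) * (2 * PI)) = 1 /\ sin ((INR l - INR k) * (2 * PI)) = 0.
Proof.
  assert (Hs : forall n, sin (2 * INR n * PI) = 0).
  { intros n; rewrite <- (Rplus_0_l (2 * INR n * PI)), sin_period; apply sin_0. }
  assert (Hc : forall n, cos (2 * INR n * PI) = 1).
  { intros n; rewrite <- (Rplus_0_l (2 * INR n * PI)), cos_period; apply cos_0. }
  replace ((INR l - INR k) * (2 * PI)) with (2 * INR l * PI - 2 * INR k * PI) by ring.
  rewrite cos_minus, sin_minus, !Hs, !Hc; split; ring.
Qed.

(** Orthogonality of the exponentials: for l <> k the primitives sin(w t)/w and -cos(w t)/w, with w
    = l - k, agree at 0 and 2 pi. *)
Lemma is_CInt_expi (k l : nat) :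
  is_CInt (fun t => expi (INR l * t) * expi (- (INR k * t)))%C
    (if Nat.eqb l k then RtoC (2 * PI) else RtoC 0).
Proof.
  apply is_CInt_ext with (fun t => expi ((INR l - INR k) * t)).
  { intros t; rewrite <- expi_plus; f_equal; ring. }
  destruct (Nat.eqb_spec l k) as [->|Hlk].
  - rewrite Rminus_diag; split; simpl.
    + apply is_RInt_ext with (fun _ => 1).
      { intros; rewrite Rmult_0_l; now rewrite cos_0. }
      evar_last; [apply (is_RInt_const 0 (2 * PI) 1)|].
      unfold scal; simpl; unfold mult; simpl; ring.
    + apply is_RInt_ext with (fun _ => 0).
      { intros; rewrite Rmult_0_l; now rewrite sin_0. }
      evar_last; [apply (is_RInt_const 0 (2 * PI) 0)|].
      unfold scal; simpl; unfold mult; simpl; ring.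
  - assert (Hw : INR l - INR k <> 0).
    { intros H; apply Hlk, INR_eq; lra. }
    destruct (cos_sin_int k l) as [Hc Hs].
    set (w := INR l - INR k) in *.
    split; simpl.
    + evar_last; [apply (is_RInt_derive (fun t => sin (w * t) / w))|].
      * intros x _; auto_derive; [easy|field; easy].
      * intros x _; apply (@ex_derive_continuous R_AbsRing R_NormedModule); auto_derive; easy.
      * simpl; rewrite Hs, Rmult_0_r, sin_0; unfold minus, plus, opp; simpl; field; easy.
    + evar_last; [apply (is_RInt_derive (fun t => - cos (w * t) / w))|].
      * intros x _; auto_derive; [easy|field; easy].
      * intros x _; apply (@ex_derive_continuous R_AbsRing R_NormedModule); auto_derive; easy.
      * simpl; rewrite Hc, Rmult_0_r, cos_0; unfold minus, plus, opp; simpl; field; easy.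
Qed.

(** Fourier extraction of one coefficient. The case k > d is included so that induction on [d] can
    add one monomial at a time. *)
Lemma is_CInt_peval_coef (c : nat -> C) (d k : nat) (r : R) :
  is_CInt (fun t => peval c d (r * expi t) * expi (- (INR k * t)))%C
    (if Nat.leb k d then RtoC (2 * PI) * (c k * r ^ k) else RtoC 0)%C.
Proof.
  assert (Hmono : forall l, is_CInt
    (fun t => c l * (r * expi t) ^ l * expi (- (INR k * t)))%C
    (if Nat.eqb l k then RtoC (2 * PI) * (c k * r ^ k) else RtoC 0)%C).
  { intros l.
    apply is_CInt_ext with
      (fun t => (c l * r ^ l) * (expi (INR l * t) * expi (- (INR k * t))))%C.
    { intros t; rewrite Cpow_mult_l, expi_pow; ring. }
    assert (H := is_CInt_mult_l (c l * r ^ l)%C _ _ (is_CInt_expi k l)).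
    destruct (Nat.eqb_spec l k) as [E|_].
    - subst k; rewrite (Cmult_comm (RtoC (2 * PI))); exact H.
    - now rewrite Cmult_0_r in H. }
  induction d as [|d IH].
  - replace (Nat.leb k 0) with (Nat.eqb 0 k) by (destruct k; reflexivity).
    apply is_CInt_ext with (2 := Hmono O).
    intros t; simpl; ring.
  - eapply is_CInt_ext; [|replace (if Nat.leb k (S d) then _ else _) with
      ((if Nat.leb k d then RtoC (2 * PI) * (c k * r ^ k) else RtoC 0) +
       (if Nat.eqb (S d) k then RtoC (2 * PI) * (c k * r ^ k) else RtoC 0))%C;
       [apply (is_CInt_plus _ _ _ _ IH (Hmono (S d)))|]].
    + intros t; rewrite peval_S; ring.
    + destruct (Nat.leb_spec k d), (Nat.eqb_spec (S d) k), (Nat.leb_spec k (S d));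
        try lia; ring.
Qed.

(** The counterpart of [M1] for the truncation of degree [d]. *)
Definition polymean (a : nat -> C) (d : nat) (r : R) : R :=
  / (2 * PI) * RInt (fun t => Cmod (peval a d (r * cos t, r * sin t))) 0 (2 * PI).

Lemma Ccontinuous_polar (r : R) : Ccontinuous (fun t => (r * cos t, r * sin t)).
Proof.
  split; intros t; simpl; apply (@ex_derive_continuous R_AbsRing R_NormedModule); auto_derive; easy.
Qed.

Lemma is_RInt_polymean (a : nat -> C) (d : nat) (r : R) :
  is_RInt (fun t => Cmod (peval a d (r * cos t, r * sin t))) 0 (2 * PI)
    (2 * PI * polymean a d r).
Proof.
  unfold polymean; rewrite <- Rmult_assoc, Rinv_r, Rmult_1_l
    by (generalize two_PI_pos; lra).
  apply (RInt_correct (V := R_CompleteNormedModule)), ex_RInt_continuous_R; intros t.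
  apply continuous_Cmod, Ccontinuous_peval, Ccontinuous_polar.
Qed.

(** The term c_k r^k is the mean of the polynomial times a unimodular factor. Besides Cauchy's
    estimate, this supplies the positive lower bounds for [polymean] and [M1]. *)
Lemma coef_le_polymean (c : nat -> C) (d k : nat) (r : R) :
  0 <= r -> (k <= d)%nat -> Cmod (c k) * r ^ k <= polymean c d r.
Proof.
  intros Hr Hk; assert (Hpi := two_PI_pos).
  apply Rmult_le_reg_l with (2 * PI); [easy|].
  assert (H := is_CInt_peval_coef c d k r).
  rewrite (proj2 (Nat.leb_le k d) Hk) in H.
  replace (2 * PI * (Cmod (c k) * r ^ k)) with (Cmod (RtoC (2 * PI) * (c k * r ^ k))).
  2: { rewrite !Cmod_mult, Cmod_pow, !Cmod_R, !Rabs_pos_eq; lra. }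
  eapply Cmod_is_CInt_le; [|exact H|apply is_RInt_polymean].
  intros t; simpl; rewrite Cmod_mult, Cmod_expi, polar_expi; lra.
Qed.

Lemma polymean_le (c : nat -> C) (d : nat) (r X : R) :
  (forall t, Cmod (peval c d (r * cos t, r * sin t)) <= X) -> polymean c d r <= X.
Proof.
  intros H; assert (Hpi := two_PI_pos).
  apply Rmult_le_reg_l with (2 * PI); [easy|].
  replace (2 * PI * X) with (scal (2 * PI - 0) X)
    by (unfold scal; simpl; unfold mult; simpl; ring).
  eapply is_RInt_le; [apply Rlt_le, Hpi|apply is_RInt_polymean| |intros t _; apply H].
  apply (is_RInt_const 0 (2 * PI) X).
Qed.

Lemma cauchy_estimate (c : nat -> C) (d k : nat) (r X : R) :
  0 <= r -> (k <= d)%nat ->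
  (forall t, Cmod (peval c d (r * cos t, r * sin t)) <= X) ->
  Cmod (c k) * r ^ k <= X.
Proof.
  intros Hr Hk H; eapply Rle_trans; [now apply (coef_le_polymean c d)|].
  now apply polymean_le.
Qed.

(** A maximum principle by the power trick: Cauchy's estimate on the circle of radius [s] bounds the
    coefficients of the N-th power by X^N / s^k, and r <= s. *)
Lemma peval_le_of_circle (b : nat -> C) (d : nat) (r s X : R) :
  0 <= r <= s -> 0 < X ->
  (forall t, Cmod (peval b d (s * cos t, s * sin t)) <= X) ->
  Cmod (peval b d r) <= X.
Proof.
  intros Hr HX H.
  apply Cmod_peval_le_of_pow_coef; [lra|easy|].
  intros N c Hc k Hk.
  apply Rle_trans with (Cmod (c k) * s ^ k).
  { apply Rmult_le_compat_l; [apply Cmod_ge_0|now apply pow_incr]. }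
  apply (cauchy_estimate c (N * d)); [lra|easy|].
  intros t; rewrite Hc, Cmod_pow; apply pow_incr; split; [apply Cmod_ge_0|auto].
Qed.

Lemma exp_le (x y : R) : x <= y -> exp x <= exp y.
Proof.
  intros [H|H]; [left; now apply exp_increasing|rewrite H; apply Rle_refl].
Qed.

(** For a coefficient c_k of the N-th power, Cauchy's estimate reads ln |c_k| + k ln r <= N ln X at
    both radii. The left side is affine in ln r, so the estimates combine with weights th and 1 -
    th. *)
Lemma three_circles (b : nat -> C) (d : nat) (r1 r2 th X1 X2 : R) :
  0 < r1 -> 0 < r2 -> 0 <= th <= 1 -> 0 < X1 -> 0 < X2 ->
  (forall t, Cmod (peval b d (r1 * cos t, r1 * sin t)) <= X1) ->
  (forall t, Cmod (peval b d (r2 * cos t, r2 * sin t)) <= X2) ->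
  Cmod (peval b d (RtoC (exp (th * ln r1 + (1 - th) * ln r2)))) <=
    exp (th * ln X1 + (1 - th) * ln X2).
Proof.
  intros Hr1 Hr2 Hth HX1 HX2 H1 H2.
  apply Cmod_peval_le_of_pow_coef; [left; apply exp_pos|apply exp_pos|].
  intros N c Hc k Hk.
  assert (Hest : forall r X, 0 < r -> 0 < X ->
    (forall t, Cmod (peval b d (r * cos t, r * sin t)) <= X) ->
    Cmod (c k) * r ^ k <= X ^ N).
  { intros r X Hr HX H.
    apply (cauchy_estimate c (N * d)); [lra|easy|].
    intros t; rewrite Hc, Cmod_pow; apply pow_incr; split; [apply Cmod_ge_0|auto]. }
  assert (E1 := Hest _ _ Hr1 HX1 H1); assert (E2 := Hest _ _ Hr2 HX2 H2).
  (* A zero coefficient is set aside before taking logarithms. *)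
  destruct (Cmod_ge_0 (c k)) as [Hck|Hck].
  2: { rewrite <- Hck, Rmult_0_l; apply pow_le; left; apply exp_pos. }
  assert (Hln : forall r X, 0 < r -> 0 < X -> Cmod (c k) * r ^ k <= X ^ N ->
    ln (Cmod (c k)) + INR k * ln r <= INR N * ln X).
  { intros r X Hr HX H.
    assert (Hrk := pow_lt r k Hr).
    rewrite <- !ln_pow, <- ln_mult by easy.
    apply ln_le; [now apply Rmult_lt_0_compat|easy]. }
  apply Hln in E1; [|easy..]; apply Hln in E2; [|easy..].
  assert (Hpow : forall x m, exp x ^ m = exp (INR m * x)).
  { intros x m; rewrite <- (exp_ln (exp x ^ m)) by apply pow_lt, exp_pos.
    now rewrite ln_pow, ln_exp by apply exp_pos. }
  rewrite <- (exp_ln (Cmod (c k))), !Hpow, <- exp_plus by easy.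
  apply exp_le.
  apply (Rmult_le_compat_l th) in E1; [|lra].
  apply (Rmult_le_compat_l (1 - th)) in E2; [|lra].
  lra.
Qed.

(** * Log-convexity for polynomials *)

(** Shifting the interval to [u, 2 pi + u] exchanges the piece [0, u] for [2 pi, 2 pi + u], which
    has the same integral by periodicity. *)
Lemma is_RInt_rotate (h : R -> R) (u l : R) :
  (forall t, continuous h t) -> (forall t, h (t + 2 * PI) = h t) ->
  is_RInt h 0 (2 * PI) l -> is_RInt (fun t => h (t + u)) 0 (2 * PI) l.
Proof.
  intros Hc Hp Hl.
  assert (Hex : forall a b, is_RInt h a b (RInt h a b)).
  { intros a b; apply (RInt_correct (V := R_CompleteNormedModule)).
    now apply ex_RInt_continuous_R. }
  assert (Hshift : forall v a b,
    is_RInt (fun t => h (t + v)) a b (RInt h (a + v) (b + v))).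
  { intros v a b; apply is_RInt_ext with (fun t => scal 1 (h (1 * t + v))).
    { intros t _; change (1 * h (1 * t + v) = h (t + v)); now rewrite !Rmult_1_l. }
    apply (is_RInt_comp_lin h).
    replace (1 * a + v) with (a + v) by ring.
    replace (1 * b + v) with (b + v) by ring; apply Hex. }
  evar_last; [apply Hshift|].
  assert (H0 : RInt h 0 (2 * PI) = l) by now apply is_RInt_unique.
  assert (H1 : RInt h (2 * PI) (2 * PI + u) = RInt h 0 u).
  { assert (H := Hshift (2 * PI) 0 u).
    apply (is_RInt_unique (V := R_CompleteNormedModule)) in H.
    replace (2 * PI + u) with (u + 2 * PI) by ring.
    rewrite Rplus_0_l in H; rewrite <- H; apply RInt_ext; intros; apply Hp. }
  assert (Hch : forall a b c, RInt h a b + RInt h b c = RInt h a c).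
  { intros a b c; apply (RInt_Chasles h a b c); now apply ex_RInt_continuous_R. }
  assert (H2 := Hch 0 u (2 * PI + u)).
  assert (H3 := Hch 0 (2 * PI) (2 * PI + u)).
  rewrite Rplus_0_l; lra.
Qed.

(** Pairing with [g] multiplies each coefficient by a Fourier coefficient of [g], so the result is
    again a polynomial in [z]. The [+ 0] matches the form of [Ccontinuous_expi_lin]. *)
Lemma is_CInt_peval_mult (a : nat -> C) (d : nat) (g : R -> C) (z : C) :
  Ccontinuous g ->
  is_CInt (fun t => peval a d (z * expi t) * g t)%C
    (peval (fun k => a k * CInt (fun t => expi (INR k * t + 0) * g t))%C d z).
Proof.
  intros Hg.
  assert (Hm : forall k, is_CInt (fun t => a k * (z * expi t) ^ k * g t)%C
    (a k * CInt (fun t => expi (INR k * t + 0) * g t) * z ^ k)%C).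
  { intros k; apply is_CInt_ext with
      (fun t => (a k * z ^ k) * (expi (INR k * t + 0) * g t))%C.
    { intros t; rewrite Cpow_mult_l, expi_pow, Rplus_0_r; ring. }
    rewrite <- Cmult_assoc, (Cmult_comm (CInt _)), Cmult_assoc.
    apply is_CInt_mult_l, CInt_correct, Ccontinuous_mult; [|easy].
    apply Ccontinuous_expi_lin. }
  induction d as [|d IH].
  - simpl. rewrite <- (Cmult_1_r (_ * _)%C).
    apply is_CInt_ext with (2 := Hm O); intros t; simpl; ring.
  - rewrite peval_S; apply is_CInt_ext with (2 := is_CInt_plus _ _ _ _ IH (Hm (S d))).
    intros t; rewrite peval_S; ring.
Qed.

(* Testing against conj p / (|p| + eps), a continuous substitute for the sign of p,
   turns the mean of |p| on one circle into the value of a polynomial at one point. *)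
Lemma polymean_dual (a : nat -> C) (d : nat) (r eps : R) : 0 < eps ->
  exists b : nat -> C,
    (forall s t, Cmod (peval b d (s * cos t, s * sin t)) <= polymean a d s) /\
    polymean a d r - eps <= Cmod (peval b d r).
Proof.
  intros Heps; assert (Hpi := two_PI_pos).
  pose (p := fun t => peval a d (r * cos t, r * sin t)).
  pose (g := fun t => (Cconj (p t) * RtoC (/ (Cmod (p t) + eps)))%C).
  assert (Hp : Ccontinuous p) by apply Ccontinuous_peval, Ccontinuous_polar.
  assert (Hden : forall t, 0 < Cmod (p t) + eps).
  { intros t; generalize (Cmod_ge_0 (p t)); lra. }
  assert (Hg : Ccontinuous g).
  { apply Ccontinuous_mult; [now apply Ccontinuous_conj|].
    apply Ccontinuous_RtoC; intros t.
    apply (continuous_comp (fun t => Cmod (p t) + eps) Rinv).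
    - apply (continuous_plus (fun t => Cmod (p t)) (fun _ => eps)).
      + now apply continuous_Cmod.
      + apply continuous_const.
    - apply continuous_Rinv; generalize (Hden t); lra. }
  assert (Hg1 : forall t, Cmod (g t) <= 1).
  { intros t; unfold g; rewrite Cmod_mult, Cmod_conj, Cmod_R, Rabs_pos_eq.
    2: { left; apply Rinv_0_lt_compat, Hden. }
    apply Rmult_le_reg_r with (Cmod (p t) + eps); [easy|].
    rewrite Rmult_assoc, Rinv_l by (generalize (Hden t); lra); lra. }
  pose (b0 := fun k => (a k * CInt (fun t => expi (INR k * t + 0) * g t))%C).
  assert (Hb0 : forall z, is_CInt (fun t => peval a d (z * expi t) * g t)%C (peval b0 d z)).
  { intros z; now apply is_CInt_peval_mult. }
  exists (fun k => RtoC (/ (2 * PI)) * b0 k)%C.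
  assert (Hscal : forall z, Cmod (peval (fun k => RtoC (/ (2 * PI)) * b0 k)%C d z)
     = / (2 * PI) * Cmod (peval b0 d z)).
  { intros z; rewrite peval_scal, Cmod_mult, Cmod_R, Rabs_pos_eq; [easy|].
    left; now apply Rinv_0_lt_compat. }
  split.
  - intros s t; rewrite Hscal.
    apply Rmult_le_reg_l with (2 * PI); [easy|].
    rewrite <- Rmult_assoc, Rinv_r, Rmult_1_l by lra.
    eapply Cmod_is_CInt_le; [|apply Hb0|].
    (* Evaluating at s e^{it} only rotates the circle of radius [s] by the angle [t], which
       preserves the mean. *)
    2: { apply (is_RInt_rotate
           (fun u => Cmod (peval a d (s * cos u, s * sin u))) t);
           [| |apply is_RInt_polymean].
         - intros u; apply continuous_Cmod, Ccontinuous_peval, Ccontinuous_polar.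
         - intros u.
           replace (u + 2 * PI) with (u + 2 * INR 1 * PI) by (simpl; ring).
           now rewrite cos_period, sin_period. }
    intros u; simpl; rewrite !polar_expi, Cmod_mult.
    rewrite <- Cmult_assoc, <- expi_plus, (Rplus_comm t).
    rewrite <- (Rmult_1_r (Cmod (peval a d _))) at 2.
    apply Rmult_le_compat_l; [apply Cmod_ge_0|easy].
  - rewrite Hscal.
    apply Rmult_le_reg_l with (2 * PI); [easy|].
    rewrite <- Rmult_assoc, Rinv_r, Rmult_1_l by lra.
    (* On the circle of radius [r] the product [p t * g t] is real, so bounding the real part from
       below loses nothing. *)
    eapply Rle_trans; [|apply re_le_Cmod].
    eapply Rle_trans; [|apply Rle_abs].
    rewrite Rmult_minus_distr_l.
    eapply (is_RInt_le (fun t => Cmod (p t) - eps)); [apply Rlt_le, Hpi| |apply Hb0|].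
    + apply (is_RInt_minus (fun t => Cmod (p t)) (fun _ => eps)); [apply is_RInt_polymean|].
      evar_last; [apply (is_RInt_const 0 (2 * PI) eps)|].
      unfold scal; simpl; unfold mult; simpl; ring.
    + intros t _; change (Cmod (p t) - eps <= fst (peval a d (r * expi t) * g t)%C).
      rewrite <- polar_expi; fold (p t).
      replace (p t * g t)%C with (RtoC (Cmod (p t) ^ 2 * / (Cmod (p t) + eps))).
      2: { unfold g; rewrite RtoC_mult, Cmod2_conj; ring. }
      simpl fst.
      apply Rmult_le_reg_r with (Cmod (p t) + eps); [easy|].
      rewrite Rmult_assoc, Rinv_l by (generalize (Hden t); lra).
      (* With x = |p(t)| this is (x - eps)(x + eps) <= x^2. *)
      nra.
Qed.

(** The maximum principle applied to the dual polynomial for the radius [r], which is bounded by the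
    mean at [s] on the outer circle; then eps -> 0. *)
Lemma polymean_incr (a : nat -> C) (d : nat) (r s : R) :
  0 <= r <= s -> 0 < polymean a d s -> polymean a d r <= polymean a d s.
Proof.
  intros Hr Hs; apply le_epsilon; intros eps Heps.
  destruct (polymean_dual a d r eps Heps) as [b [Hb Hbr]].
  assert (H := peval_le_of_circle b d r s _ Hr Hs (Hb s)); lra.
Qed.

(** Three circles applied to the dual polynomial for the intermediate radius, whose bounds on the
    two outer circles are the means there. *)
Lemma polymean_log_convex (a : nat -> C) (d : nat) (r1 r2 th : R) :
  0 < r1 -> 0 < r2 -> 0 <= th <= 1 ->
  0 < polymean a d r1 -> 0 < polymean a d r2 ->
  polymean a d (exp (th * ln r1 + (1 - th) * ln r2)) <=
    exp (th * ln (polymean a d r1) + (1 - th) * ln (polymean a d r2)).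
Proof.
  intros Hr1 Hr2 Hth H1 H2; apply le_epsilon; intros eps Heps.
  destruct (polymean_dual a d (exp (th * ln r1 + (1 - th) * ln r2)) eps Heps)
    as [b [Hb Hbr]].
  assert (H := three_circles b d r1 r2 th _ _ Hr1 Hr2 Hth H1 H2 (Hb r1) (Hb r2)); lra.
Qed.

(** * Power series as limits of polynomials *)

(** The bound depends on [v] only, hence is uniform over all series dominated by [v]. *)
Lemma Series_tail_le (u v : nat -> R) (d : nat) :
  (forall k, Rabs (u k) <= v k) -> ex_series v ->
  Rabs (Series u - sum_f_R0 u d) <= Series v - sum_f_R0 v d.
Proof.
  intros Huv Hv.
  assert (Hu : ex_series u) by now apply (ex_series_le u v).
  rewrite (Series_incr_n u (S d)), (Series_incr_n v (S d)) by (easy || lia).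
  simpl pred.
  replace (sum_f_R0 u d + Series (fun k => u (S d + k)%nat) - sum_f_R0 u d)
    with (Series (fun k => u (S d + k)%nat)) by ring.
  replace (sum_f_R0 v d + Series (fun k => v (S d + k)%nat) - sum_f_R0 v d)
    with (Series (fun k => v (S d + k)%nat)) by ring.
  assert (Hv' : ex_series (fun k => v (S d + k)%nat)) by (apply (ex_series_incr_n v (S d)); easy).
  assert (Hu' : ex_series (fun k => Rabs (u (S d + k)%nat))).
  { apply (ex_series_le (V := R_CompleteNormedModule) _ (fun k => v (S d + k)%nat)); [|easy].
    intros k; unfold norm; simpl; unfold abs; simpl; rewrite Rabs_Rabsolu; apply Huv. }
  eapply Rle_trans; [now apply Series_Rabs|].
  apply Series_le; [|easy]. intros k; split; [apply Rabs_pos|apply Huv].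
Qed.

Lemma C_pow_n (z : C) (k : nat) : pow_n z k = (z ^ k)%C.
Proof. induction k as [|k IH]; [easy|]; simpl; now rewrite IH. Qed.

Lemma Re_peval (a : nat -> C) (d : nat) (z : C) :
  Re (peval a d z) = sum_f_R0 (fun k => Re (mult (a k) (pow_n z k))) d.
Proof.
  induction d as [|d IH].
  - change (Re (a O) = Re (a O * 1)%C); now rewrite Cmult_1_r.
  - rewrite tech5, <- IH, C_pow_n; reflexivity.
Qed.

Lemma Im_peval (a : nat -> C) (d : nat) (z : C) :
  Im (peval a d z) = sum_f_R0 (fun k => Im (mult (a k) (pow_n z k))) d.
Proof.
  induction d as [|d IH].
  - change (Im (a O) = Im (a O * 1)%C); now rewrite Cmult_1_r.
  - rewrite tech5, <- IH, C_pow_n; reflexivity.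
Qed.

Lemma Cmod_le_abs (z : C) : Cmod z <= Rabs (Re z) + Rabs (Im z).
Proof.
  assert (H1 := Rabs_pos (Re z)); assert (H2 := Rabs_pos (Im z)).
  apply Rsqr_incr_0_var; [|lra].
  rewrite !Rsqr_pow2, Cmod2_alt.
  rewrite <- (pow2_abs (Re z)), <- (pow2_abs (Im z)); nra.
Qed.

(** Real and imaginary parts are estimated separately, whence the factor 2. The bound depends on [z]
    through [Cmod z] only, so it is uniform on circles. *)
Lemma psum_peval_tail (a : nat -> C) (d : nat) (z : C) :
  ex_series (fun k => Cmod (a k) * Cmod z ^ k) ->
  Cmod (psum a z - peval a d z) <=
    2 * (Series (fun k => Cmod (a k) * Cmod z ^ k)
         - sum_f_R0 (fun k => Cmod (a k) * Cmod z ^ k) d).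
Proof.
  intros Hs.
  assert (Hterm : forall k, Rmax (Rabs (Re (mult (a k) (pow_n z k))))
      (Rabs (Im (mult (a k) (pow_n z k)))) <= Cmod (a k) * Cmod z ^ k).
  { intros k; rewrite C_pow_n, <- Cmod_pow, <- Cmod_mult; apply Rmax_Cmod. }
  assert (HR := Series_tail_le _ _ d
    (fun k => Rle_trans _ _ _ (Rmax_l _ _) (Hterm k)) Hs).
  assert (HI := Series_tail_le _ _ d
    (fun k => Rle_trans _ _ _ (Rmax_r _ _) (Hterm k)) Hs).
  rewrite <- Re_peval in HR; rewrite <- Im_peval in HI.
  eapply Rle_trans; [apply Cmod_le_abs|].
  rewrite <- Rplus_diag; exact (Rplus_le_compat _ _ _ _ HR HI).
Qed.

Lemma Rabs_Cmod_minus_le (x y : C) : Rabs (Cmod y - Cmod x) <= Cmod (x - y).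
Proof.
  assert (H1 := Cmod_triangle (x - y) y); assert (H2 := Cmod_triangle (y - x) x).
  replace (x - y + y)%C with x in H1 by ring.
  replace (y - x + x)%C with y in H2 by ring.
  replace (y - x)%C with (- (x - y))%C in H2 by ring.
  rewrite Cmod_opp in H2.
  apply Rabs_le; lra.
Qed.

Lemma polymean_cvg (a : nat -> C) (r : R) : 0 <= r ->
  ex_series (fun k => Cmod (a k) * r ^ k) ->
  is_lim_seq (fun d => polymean a d r) (M1 a r).
Proof.
  intros Hr Hs; assert (Hpi := two_PI_pos).
  (* Uniform convergence gives at once the integrability of the limit and the convergence of the
     integrals. *)
  destruct (filterlim_RInt (V := R_CompleteNormedModule)
    (fun d t => Cmod (peval a d (r * cos t, r * sin t))) 0 (2 * PI) eventually _
    (fun t => Cmod (psum a (r * cos t, r * sin t)))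
    (fun d => 2 * PI * polymean a d r)) as [I [HI1 HI2]].
  - intros d; apply is_RInt_polymean.
  - apply filterlim_locally; intros eps.
    assert (Hl : is_lim_seq (fun d => Series (fun k => Cmod (a k) * r ^ k)
       - sum_f_R0 (fun k => Cmod (a k) * r ^ k) d) 0).
    { evar_last.
      - apply is_lim_seq_minus'; [apply is_lim_seq_const|].
        apply is_lim_seq_ext with (sum_n (fun k => Cmod (a k) * r ^ k)).
        { intros d; apply sum_n_Reals. }
        apply (Series_correct _ Hs).
      - simpl; f_equal; ring. }
    apply is_lim_seq_spec in Hl.
    (* Half of [eps] absorbs the factor 2 of [psum_peval_tail]. *)
    assert (He2 : 0 < eps / 2) by (generalize (cond_pos eps); lra).
    destruct (Hl (mkposreal _ He2)) as [N HN]; simpl in HN.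
    exists N; intros d Hd t.
    change (Rabs (Cmod (peval a d (r * cos t, r * sin t)) -
                  Cmod (psum a (r * cos t, r * sin t))) < eps).
    eapply Rle_lt_trans; [apply Rabs_Cmod_minus_le|].
    eapply Rle_lt_trans; [apply psum_peval_tail|];
      rewrite Cmod_polar by easy; [easy|].
    specialize (HN d Hd); rewrite Rminus_0_r in HN.
    apply Rabs_def2 in HN; lra.
  - unfold M1.
    rewrite (is_RInt_unique (V := R_CompleteNormedModule) _ _ _ _ HI2).
    apply is_lim_seq_ext with (fun d => / (2 * PI) * (2 * PI * polymean a d r)).
    { intros d; field; generalize PI_RGT_0; lra. }
    apply (is_lim_seq_scal_l _ _ I), HI1.
Qed.

Lemma M1_approx (a : nat -> C) (Rad r : R) :
  radius a = Finite Rad -> 0 < r < Rad -> is_lim_seq (fun d => polymean a d r) (M1 a r).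
Proof.
  intros Hrad Hr; apply polymean_cvg; [lra|].
  apply ex_series_ext with (fun k => Rabs (Cmod (a k) * r ^ k)).
  { intros k; apply Rabs_pos_eq, Rmult_le_pos; [apply Cmod_ge_0|apply pow_le; lra]. }
  apply CV_disk_inside; unfold radius in Hrad; rewrite Hrad; simpl.
  rewrite Rabs_pos_eq; lra.
Qed.

Lemma polymean_pos (a : nat -> C) (n d : nat) (r : R) :
  a n <> 0%C -> 0 < r -> (n <= d)%nat -> 0 < polymean a d r.
Proof.
  intros Han Hr Hd; apply Rlt_le_trans with (Cmod (a n) * r ^ n).
  - apply Rmult_lt_0_compat; [now apply Cmod_gt_0|now apply pow_lt].
  - apply coef_le_polymean; [lra|easy].
Qed.

(** The lower bound |a_n| r^n for the truncated means does not depend on [d], so it survives the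
    limit. *)
Lemma M1_pos (a : nat -> C) (Rad : R) (n : nat) (r : R) :
  radius a = Finite Rad -> a n <> 0%C -> 0 < r < Rad -> 0 < M1 a r.
Proof.
  intros Hrad Han Hr; apply Rlt_le_trans with (Cmod (a n) * r ^ n).
  - apply Rmult_lt_0_compat; [now apply Cmod_gt_0|now apply pow_lt].
  - apply (is_lim_seq_le_loc (fun _ => Cmod (a n) * r ^ n)
      (fun d => polymean a d r) (Cmod (a n) * r ^ n) (M1 a r)).
    + exists n; intros d Hd; apply coef_le_polymean; [lra|easy].
    + apply is_lim_seq_const.
    + now apply M1_approx with Rad.
Qed.

Lemma M1_incr (a : nat -> C) (Rad : R) (n : nat) (r s : R) :
  radius a = Finite Rad -> a n <> 0%C -> 0 < r -> r <= s -> s < Rad -> M1 a r <= M1 a s.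
Proof.
  intros Hrad Han Hr Hrs Hs.
  apply (is_lim_seq_le_loc (fun d => polymean a d r)
      (fun d => polymean a d s) (M1 a r) (M1 a s)).
  - exists n; intros d Hd; apply polymean_incr; [lra|].
    apply polymean_pos with n; [easy|lra|easy].
  - apply M1_approx with Rad; [easy|lra].
  - apply M1_approx with Rad; [easy|lra].
Qed.

(** Hardy's convexity theorem, as the limit of its polynomial case. Denominators are cleared so that
    chord comparisons become linear arithmetic. *)
Lemma sigma_convex (a : nat -> C) (Rad : R) (n : nat) (r1 r r2 : R) :
  radius a = Finite Rad -> a n <> 0%C -> 0 < r1 -> r1 < r -> r < r2 -> r2 < Rad ->
  (ln r2 - ln r1) * Defs.sigma a r <=
    (ln r2 - ln r) * Defs.sigma a r1 + (ln r - ln r1) * Defs.sigma a r2.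
Proof.
  intros Hrad Han H0 H1 H2 H3.
  assert (L1 : ln r1 < ln r) by (apply ln_increasing; lra).
  assert (L2 : ln r < ln r2) by (apply ln_increasing; lra).
  set (L := ln r2 - ln r1).
  (* The weight for which ln r = th ln r1 + (1 - th) ln r2. *)
  set (th := (ln r2 - ln r) / L).
  assert (HL : 0 < L) by (unfold L; lra).
  assert (Hth : 0 <= th <= 1).
  { split; apply Rmult_le_reg_r with L; unfold th; try easy; field_simplify; unfold L; lra. }
  assert (Hr : exp (th * ln r1 + (1 - th) * ln r2) = r).
  { rewrite <- (exp_ln r) by lra; f_equal; unfold th, L; field; lra. }
  assert (Hl : forall s, 0 < s < Rad ->
    is_lim_seq (fun d => ln (polymean a d s)) (Defs.sigma a s)).
  { intros s Hs; apply (is_lim_seq_continuous ln); [|now apply M1_approx with Rad].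
    apply continuity_pt_filterlim, continuous_ln, M1_pos with Rad n; easy. }
  assert (Hle : Defs.sigma a r <= th * Defs.sigma a r1 + (1 - th) * Defs.sigma a r2).
  { apply (is_lim_seq_le_loc (fun d => ln (polymean a d r))
      (fun d => th * ln (polymean a d r1) + (1 - th) * ln (polymean a d r2))
      (Defs.sigma a r) (th * Defs.sigma a r1 + (1 - th) * Defs.sigma a r2)).
    (* Truncations of degree at least [n] contain the nonzero coefficient [a n], so their means are
       positive and logarithms can be compared. *)
    - exists n; intros d Hd.
      assert (Hp : forall s, 0 < s -> 0 < polymean a d s).
      { intros s Hs; now apply polymean_pos with n. }
      rewrite <- (ln_exp (th * _ + _)).
      apply ln_le; [apply Hp; lra|].
      rewrite <- Hr at 1; apply polymean_log_convex; try apply Hp; lra.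
    - apply Hl; lra.
    - apply is_lim_seq_plus'; apply (is_lim_seq_scal_l _ _ (Finite _)), Hl; lra. }
  apply (Rmult_le_compat_l L) in Hle; [|lra].
  eapply Rle_trans; [exact Hle|].
  right; unfold th, L; field; unfold L in HL; lra.
Qed.

(** * Chord slopes and the theorem *)

(* [Derive] is, by definition, a limit along the positive sequence 1/(n+1), so it is
   bounded by chord slopes from either side without any differentiability. *)
Lemma Derive_log_chords (phi : R -> R) (Rad s r u : R) :
  (forall r1 r r2, 0 < r1 -> r1 < r -> r < r2 -> r2 < Rad ->
    (ln r2 - ln r1) * phi r <= (ln r2 - ln r) * phi r1 + (ln r - ln r1) * phi r2) ->
  0 < s -> s < r -> r < u -> u < Rad ->
  phi r - phi s <= r * Derive phi r * (ln r - ln s) /\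
  r * Derive phi r * (ln u - ln r) <= phi u - phi r.
Proof.
  intros Hconv Hs Hsr Hru Hu.
  assert (L1 : ln s < ln r) by (apply ln_increasing; lra).
  assert (L2 : ln r < ln u) by (apply ln_increasing; lra).
  set (K1 := (phi r - phi s) / (ln r - ln s)).
  set (K2 := (phi u - phi r) / (ln u - ln r)).
  pose (x := fun n : nat => Rbar_loc_seq 0 n).
  (* The factor [g], which tends to 1/r, converts slopes against ln r into difference quotients [q]
     in r. *)
  pose (g := fun n => (ln (r + x n) - ln r) / x n).
  pose (q := fun n => (phi (r + x n) - phi r) / x n).
  assert (Hx : forall n, x n = / (INR n + 1)).
  { intros n; unfold x; simpl; ring. }
  assert (Hx0 : forall n, 0 < x n).
  { intros n; rewrite Hx; apply Rinv_0_lt_compat; generalize (pos_INR n); lra. }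
  assert (Hxs : is_lim_seq x 0) by apply (is_lim_seq_Rbar_loc_seq 0).
  apply is_lim_seq_spec in Hxs.
  assert (Hxe : forall eps, 0 < eps -> eventually (fun n => x n < eps)).
  { intros eps He; destruct (Hxs (mkposreal eps He)) as [N HN]; exists N; intros n Hn.
    specialize (HN n Hn); simpl in HN; rewrite Rminus_0_r in HN.
    now apply Rabs_def2 in HN. }
  assert (Hg : is_lim_seq g (/ r)).
  { apply is_lim_seq_spec; intros eps.
    assert (Hd := derivable_pt_lim_ln r (Rlt_trans _ _ _ Hs Hsr)).
    destruct (Hd eps (cond_pos eps)) as [del Hdel].
    destruct (Hxe del (cond_pos del)) as [N HN]; exists N; intros n Hn.
    apply Hdel; [apply Rgt_not_eq, Hx0|].
    rewrite Rabs_pos_eq; [now apply HN|apply Rlt_le, Hx0]. }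
  (* Once r + x_n < u, convexity places the slope of the short chord from r to r + x_n between those
     of the chords from s to r and from r to u. *)
  assert (Hbnd : eventually (fun n => K1 * g n <= q n <= K2 * g n)).
  { destruct (Hxe (u - r)) as [N HN]; [lra|].
    exists N; intros n Hn; specialize (HN n Hn); assert (Hpos := Hx0 n).
    assert (Lx : ln r < ln (r + x n)) by (apply ln_increasing; lra).
    assert (Lxu : ln (r + x n) < ln u) by (apply ln_increasing; lra).
    assert (Hi := Rinv_0_lt_compat _ Hpos).
    assert (C1 := Hconv s r (r + x n) ltac:(lra) ltac:(lra) ltac:(lra) ltac:(lra)).
    assert (C2 := Hconv r (r + x n) u ltac:(lra) ltac:(lra) ltac:(lra) ltac:(lra)).
    unfold g, q, Rdiv; rewrite <- !Rmult_assoc.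
    split; (apply Rmult_le_compat_r; [lra|]).
    - apply Rmult_le_reg_r with (ln r - ln s); [lra|].
      replace (K1 * (ln (r + x n) - ln r) * (ln r - ln s))
        with ((phi r - phi s) * (ln (r + x n) - ln r)) by (unfold K1; field; lra).
      lra.
    - apply Rmult_le_reg_r with (ln u - ln r); [lra|].
      replace (K2 * (ln (r + x n) - ln r) * (ln u - ln r))
        with ((phi u - phi r) * (ln (r + x n) - ln r)) by (unfold K2; field; lra).
      lra. }
  assert (HK : forall K, Lim_seq (fun n => K * g n) = Finite (K * / r)).
  { intros K; apply is_lim_seq_unique, (is_lim_seq_scal_l _ _ (Finite _)), Hg. }
  assert (Q1 : Rbar_le (K1 * / r) (Lim_seq q)).
  { rewrite <- HK; apply Lim_seq_le_loc.
    destruct Hbnd as [N HN]; exists N; intros n Hn; now apply HN. }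
  assert (Q2 : Rbar_le (Lim_seq q) (K2 * / r)).
  { rewrite <- HK; apply Lim_seq_le_loc.
    destruct Hbnd as [N HN]; exists N; intros n Hn; now apply HN. }
  assert (HD : Derive phi r = real (Lim_seq q)) by reflexivity.
  rewrite HD.
  (* The finite bounds exclude infinite values of the limit, which [real] would turn into 0. *)
  destruct (Lim_seq q) as [D| |]; [|easy|easy]; simpl in Q1, Q2 |- *.
  apply (Rmult_le_compat_l r) in Q1; [|lra].
  apply (Rmult_le_compat_l r) in Q2; [|lra].
  replace (r * (K1 * / r)) with K1 in Q1 by (field; lra).
  replace (r * (K2 * / r)) with K2 in Q2 by (field; lra).
  split.
  - replace (phi r - phi s) with (K1 * (ln r - ln s)) by (unfold K1; field; lra).
    apply Rmult_le_compat_r; lra.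
  - replace (phi u - phi r) with (K2 * (ln u - ln r)) by (unfold K2; field; lra).
    apply Rmult_le_compat_r; lra.
Qed.

Lemma filterlim_at_left_Lub (f : R -> R) (b : R) : 0 < b ->
  (forall r s, 0 < r -> r <= s -> s < b -> f r <= f s) ->
  filterlim f (at_left b) (Rbar_locally (Lub_Rbar (fun y => exists r, 0 < r < b /\ y = f r))).
Proof.
  intros Hb Hincr.
  set (E := fun y => exists r, 0 < r < b /\ y = f r).
  destruct (Lub_Rbar_correct E) as [Hub Hlub].
  assert (Hev : forall c : R, Rbar_lt c (Lub_Rbar E) -> at_left b (fun s => c < f s)).
  { intros c Hc.
    assert (Hr : exists r, 0 < r < b /\ c < f r).
    { destruct (Classical_Prop.classic (exists r, 0 < r < b /\ c < f r)) as [|Hn]; [easy|].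
      exfalso; apply (Rbar_lt_not_le _ _ Hc), Hlub.
      intros y [r [Hr ->]]; simpl; apply Rnot_lt_le; intros H; apply Hn; now exists r. }
    destruct Hr as [r [Hr Hcr]].
    assert (He : 0 < b - r) by lra.
    exists (mkposreal _ He); intros s Hs Hsb.
    change (Rabs (s - b) < b - r) in Hs; apply Rabs_def2 in Hs.
    apply Rlt_le_trans with (f r); [easy|apply Hincr; lra]. }
  assert (Hle : at_left b (fun s => Rbar_le (f s) (Lub_Rbar E))).
  (* The radius [b] keeps [s] positive. *)
  { exists (mkposreal b Hb); intros s Hs Hsb.
    change (Rabs (s - b) < b) in Hs; apply Rabs_def2 in Hs.
    apply Hub; exists s; split; [lra|easy]. }
  destruct (Lub_Rbar E) as [M| |].
  - apply filterlim_locally; intros eps.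
    assert (Heps := cond_pos eps).
    assert (Hlt : M - eps < M) by lra.
    generalize (filter_and _ _ (Hev (M - eps) Hlt) Hle).
    apply filter_imp; intros s [H1 H2]; simpl in H2.
    change (Rabs (f s - M) < eps); apply Rabs_def1; lra.
  - intros P [c Hc]; generalize (Hev c I).
    apply (filter_imp (F := at_left b)); intros s; apply Hc.
  - exfalso; apply (Hub (f (b / 2))); exists (b / 2); split; [lra|easy].
Qed.

Lemma kappa_exp (a : nat -> C) (Rad : R) (m : nat) (r : R) :
  radius a = Finite Rad -> a m <> 0%C -> 0 < r < Rad ->
  kappa a m r = exp (Defs.sigma a r - INR m * ln r) / Cmod (a m).
Proof.
  intros Hrad Ham Hr.
  assert (Hc := proj1 (Cmod_gt_0 _) Ham).
  assert (Hrm := pow_lt r m (proj1 Hr)).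
  unfold kappa, Defs.sigma, Rminus.
  rewrite exp_plus, exp_Ropp, exp_ln by now apply M1_pos with Rad m.
  rewrite <- ln_pow, exp_ln by easy.
  field; lra.
Qed.

Theorem theorem4p5 (a : nat -> C) (Rad : R) (n : nat)
  (HR : 0 < Rad) (Hrad : radius a = Finite Rad) (Han : a n <> 0%C) :
  (exists l : Rbar,
      filterlim (kappa a n) (at_left Rad) (Rbar_locally l) /\
      l = Rbar_mult (hardy_norm a Rad) (Finite (/ (Cmod (a n) * Rad ^ n))) /\
      (is_finite l <-> in_H1 a Rad)) /\
  (Rbar_lt (nu a Rad) (INR n) ->
     forall r1 r2, 0 < r1 -> r1 < r2 -> r2 < Rad -> kappa a n r2 < kappa a n r1) /\
  (nu a Rad = p_infty ->
     forall m : nat, a m <> 0%C ->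
       exists r0, 0 <= r0 < Rad /\
         forall r1 r2, r0 < r1 -> r1 < r2 -> r2 < Rad -> kappa a m r1 < kappa a m r2).
Proof.
  assert (Hchord := fun s r u => Derive_log_chords (Defs.sigma a) Rad s r u
    (fun r1 r r2 => sigma_convex a Rad n r1 r r2 Hrad Han)).
  assert (Hexp : forall m x y, a m <> 0%C -> x < y ->
    exp x / Cmod (a m) < exp y / Cmod (a m)).
  { intros m x y Ham Hxy; apply Rmult_lt_compat_r; [|now apply exp_increasing].
    now apply Rinv_0_lt_compat, Cmod_gt_0. }
  split; [|split].
  - assert (Hc : 0 < / (Cmod (a n) * Rad ^ n)).
    { apply Rinv_0_lt_compat, Rmult_lt_0_compat; [now apply Cmod_gt_0|now apply pow_lt]. }
    exists (Rbar_mult (hardy_norm a Rad) (Finite (/ (Cmod (a n) * Rad ^ n)))).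
    assert (Hlub := Lub_Rbar_correct (fun y => exists r, 0 < r < Rad /\ y = M1 a r)).
    fold (hardy_norm a Rad) in Hlub.
    assert (Hlim := filterlim_at_left_Lub (M1 a) Rad HR
      (fun r s H1 H2 H3 => M1_incr a Rad n r s Hrad Han H1 H2 H3)).
    fold (hardy_norm a Rad) in Hlim.
    split; [|split; [easy|]].
    + apply (filterlim_comp_2 (H := Rbar_locally (/ (Cmod (a n) * Rad ^ n)))
        (M1 a) (fun r => / (Cmod (a n) * r ^ n)) Rmult Hlim).
      * apply (filterlim_filter_le_1 _ (filter_le_within (F := locally Rad) _)).
        apply (continuous_Rinv_comp (fun r => Cmod (a n) * r ^ n)).
        -- apply (@ex_derive_continuous R_AbsRing R_NormedModule); auto_derive; easy.
        -- intros E; rewrite E, Rinv_0 in Hc; lra.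
      * apply (filterlim_Rbar_mult (hardy_norm a Rad) (Finite _) _), Rbar_mult_correct.
        (* The second factor is positive, so the product 0 times infinity cannot occur. *)
        destruct (hardy_norm a Rad); simpl; [easy|lra|lra].
    + unfold in_H1; destruct (hardy_norm a Rad) as [M| |].
      * easy.
      * rewrite (is_Rbar_mult_unique _ _ _ (is_Rbar_mult_p_infty_pos (Finite _) Hc)); easy.
      * exfalso; apply (proj1 Hlub (M1 a (Rad / 2))).
        exists (Rad / 2); split; [lra|easy].
  - intros Hnu r1 r2 H1 H2 H3.
    rewrite !(kappa_exp a Rad) by (easy || lra).
    apply Hexp; [easy|].
    (* The chord from [r1] to [r2] has slope at most r2 sigma'(r2) <= nu < n; the third point only
       has to lie between [r2] and [Rad]. *)
    destruct (Hchord r1 r2 ((r2 + Rad) / 2)) as [Hch _]; try lra.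
    assert (L : ln r1 < ln r2) by now apply ln_increasing.
    assert (HD : r2 * Derive (Defs.sigma a) r2 < INR n).
    { destruct (Lub_Rbar_correct (fun y => exists r, 0 < r < Rad /\
        y = r * Derive (Defs.sigma a) r)) as [Hub _].
      apply (Rbar_le_lt_trans (Finite _) (nu a Rad) (Finite _)); [|easy].
      apply Hub; exists r2; split; [lra|easy]. }
    assert (r2 * Derive (Defs.sigma a) r2 * (ln r2 - ln r1) < INR n * (ln r2 - ln r1))
      by (apply Rmult_lt_compat_r; lra).
    lra.
  - intros Hnu m Ham.
    (* Otherwise [INR m] would be a finite upper bound for the slopes. *)
    assert (Hr0 : exists r0, 0 < r0 < Rad /\ INR m < r0 * Derive (Defs.sigma a) r0).
    { destruct (Classical_Prop.classic
        (exists r0, 0 < r0 < Rad /\ INR m < r0 * Derive (Defs.sigma a) r0)) as [|Hn]; [easy|].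
      exfalso.
      destruct (Lub_Rbar_correct (fun y => exists r, 0 < r < Rad /\
        y = r * Derive (Defs.sigma a) r)) as [_ Hlub].
      fold (nu a Rad) in Hlub; rewrite Hnu in Hlub.
      apply (Hlub (Finite (INR m))).
      intros y [r [Hr ->]]; simpl; apply Rnot_lt_le; intros H; apply Hn; now exists r. }
    destruct Hr0 as [r0 [Hr0 HD0]].
    exists r0; split; [lra|]; intros r1 r2 H1 H2 H3.
    rewrite !(kappa_exp a Rad) by (easy || lra).
    apply Hexp; [easy|].
    assert (L1 : ln r0 < ln r1) by (apply ln_increasing; lra).
    assert (L2 : ln r1 < ln r2) by (apply ln_increasing; lra).
    (* The chord from [r0] to [r1] lies in slope between r0 sigma'(r0) and r1 sigma'(r1), so the
       excess over [m] at [r0] persists at [r1] and passes to the chord from [r1] to [r2]. *)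
    destruct (Hchord (r0 / 2) r0 r1) as [_ C0]; try lra.
    destruct (Hchord r0 r1 r2) as [C1 C2]; try lra.
    assert (HD1 : r0 * Derive (Defs.sigma a) r0 <= r1 * Derive (Defs.sigma a) r1)
      by (apply Rmult_le_reg_r with (ln r1 - ln r0); lra).
    assert (INR m * (ln r2 - ln r1) < r1 * Derive (Defs.sigma a) r1 * (ln r2 - ln r1))
      by (apply Rmult_lt_compat_r; lra).
    lra.
Qed.
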